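(* Let $A$ be a commutative ring and let $d,r\ge 0$ be integers. If $\mathrm{Hdim}\,A\le d$ and $M$ is a finitely generated $A$-module which is locally generated by $r$ elements, then $M$ can be generated by $d+r$ elements.
   Context: For a commutative ring $A$, let $\mathrm{J}_A(0)=\{x\in A:\forall y\in A,\ 1+xy \text{ is invertible}\}$ be its Jacobson radical, and for $x\in A$ let $\mathrm{H}_A(x)=xA+(\mathrm{J}_A(0):x)$ (Heitmann boundary ideal), where $(\mathrm{J}_A(0):x)=\{b\in A: bx\in \mathrm{J}_A(0)\}$. The Heitmann dimension is defined inductively: $\mathrm{Hdim}\,A\le -1$ iff $1=0$ in $A$; for $\ell\ge 0$, $\mathrm{Hdim}\,A\le \ell$ iff $\mathrm{Hdim}(A/\mathrm{H}_A(x))\le\ell-1$ for all $x\in A$. A finitely generated module $M$ is locally generated by $r$ elements if there are $s_1,\dots,s_n\in A$ generating the unit ideal such that each $M[s_i^{-1}]$ is generated by $r$ elements over $A[s_i^{-1}]$ (classically: $M_{\mathfrak p}$ is generated by $r$ elements for every prime $\mathfrak p$). No noetherian hypothesis is made. *)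

(* Defs.v *)
From HB Require Import structures.
From mathcomp Require Import all_boot all_algebra generic_quotient ring_quotient.
From mathcomp Require Import boolp ring.

Set Implicit Arguments.
Unset Strict Implicit.
Unset Printing Implicit Defensive.

Import GRing.Theory.
Local Open Scope ring_scope.
Local Open Scope quotient_scope.

(* Rings are [comPzRingType]s, since the quotients and localizations below can
   be the zero ring. For the same reason the ideals and quotient rings of
   [ring_quotient], which are restricted to proper ideals of nonzero rings,
   cannot be used; its quotients of additive groups can. *)

HB.mixin Record isMulStable (A : pzRingType) (S : A -> bool) := {
  mul_stable : forall a, {in S, forall u, a * u \in S}
}.

#[short(type="pzIdeal")]
HB.structure Definition PzIdeal (A : pzRingType) :=
  {S of GRing.ZmodClosed A S & isMulStable A S}.

Section QuotientRing.
Variables (A : comPzRingType) (I : pzIdeal A).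

Definition quot_ring : Type := Quotient.quot I.
HB.instance Definition _ := GRing.Zmodule.on quot_ring.

Definition quot_proj (x : A) : quot_ring := \pi_(Quotient.quot I) x.
Definition quot_mul (u v : quot_ring) : quot_ring :=
  quot_proj (repr (u : Quotient.quot I) * repr (v : Quotient.quot I)).

Lemma quot_projP x y : reflect (quot_proj x = quot_proj y) (x - y \in I).
Proof. by rewrite Quotient.idealrBE; apply: eqP. Qed.

Lemma quot_proj_surj u : exists x, u = quot_proj x.
Proof. by exists (repr (u : Quotient.quot I)); rewrite /quot_proj reprK. Qed.

Lemma quot_proj_is_zmod_morphism : zmod_morphism quot_proj.
Proof. exact: (raddfB \pi_(Quotient.quot I)). Qed.

Lemma quot_projM x y : quot_proj (x * y) = quot_mul (quot_proj x) (quot_proj y).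
Proof.
rewrite /quot_mul; set x' := repr _; set y' := repr _.
have xI : x - x' \in I by apply/quot_projP; rewrite /quot_proj reprK.
have yI : y - y' \in I by apply/quot_projP; rewrite /quot_proj reprK.
apply/quot_projP; rewrite -[x * y](subrK (x * y')) -mulrBr -addrA -mulrBl.
by apply: rpredD; [|rewrite mulrC]; apply: mul_stable.
Qed.

Let quot_mulA : associative quot_mul.
Proof.
move=> u v w; have [x ->] := quot_proj_surj u; have [y ->] := quot_proj_surj v.
by have [z ->] := quot_proj_surj w; rewrite -!quot_projM mulrA.
Qed.

Let quot_mulC : commutative quot_mul.
Proof.
move=> u v; have [x ->] := quot_proj_surj u; have [y ->] := quot_proj_surj v.
by rewrite -!quot_projM mulrC.
Qed.

Let quot_mul1 : left_id (quot_proj 1) quot_mul.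
Proof.
by move=> u; have [x ->] := quot_proj_surj u; rewrite -!quot_projM mul1r.
Qed.

HB.instance Definition _ :=
  GRing.isZmodMorphism.Build A quot_ring quot_proj quot_proj_is_zmod_morphism.

Let quot_mulDl : left_distributive quot_mul +%R.
Proof.
move=> u v w; have [x ->] := quot_proj_surj u; have [y ->] := quot_proj_surj v.
have [z ->] := quot_proj_surj w.
by rewrite -!quot_projM -!raddfD /= -quot_projM mulrDl.
Qed.

HB.instance Definition _ := GRing.Zmodule_isComPzRing.Build quot_ring
  quot_mulA quot_mulC quot_mul1 quot_mulDl.

Lemma quot_proj_is_monoid_morphism : monoid_morphism quot_proj.
Proof. by split=> // x y; rewrite quot_projM. Qed.
HB.instance Definition _ := GRing.isMonoidMorphism.Build A quot_ring quot_proj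
  quot_proj_is_monoid_morphism.

End QuotientRing.

Section HeitmannBoundary.
Variable A : comPzRingType.
Implicit Types x y a b : A.

(* [GRing.unit] is not available on a [comPzRingType]. *)
Definition invertible x : Prop := exists y, x * y = 1.

Definition jacobson : {pred A} := [pred x | `[< forall y, invertible (1 + x * y) >]].

(* The ideal quotient (J_A(0) : x). *)
Definition jacobson_colon x : {pred A} := [pred b | b * x \in jacobson].

Definition heitmann x : {pred A} :=
  [pred z | `[< exists a, exists2 b, b \in jacobson_colon x & z = x * a + b >]].

Lemma jacobsonP x : reflect (forall y, invertible (1 + x * y)) (x \in jacobson).
Proof. exact: asboolP. Qed.

Lemma heitmannP x z :
  reflect (exists a, exists2 b, b \in jacobson_colon x & z = x * a + b)
          (z \in heitmann x).
Proof. exact: asboolP. Qed.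

Lemma jacobson0 : 0 \in jacobson.
Proof. by apply/jacobsonP => y; exists 1; rewrite mul0r addr0 mulr1. Qed.

Lemma jacobsonMl a x : x \in jacobson -> a * x \in jacobson.
Proof.
by move=> /jacobsonP Jx; apply/jacobsonP => y; rewrite [a * x]mulrC -mulrA.
Qed.

Lemma jacobsonD x y : x \in jacobson -> y \in jacobson -> x + y \in jacobson.
Proof.
move=> /jacobsonP Jx /jacobsonP Jy; apply/jacobsonP => z.
have [u xu] := Jx z; have [v yv] := Jy (z * u).
exists (u * v).
have -> : (1 + (x + y) * z) * (u * v) = ((1 + x * z) * u + y * (z * u)) * v.
  by ring.
by rewrite xu yv.
Qed.

Lemma heitmann_zmod_closed x : zmod_closed (heitmann x).
Proof.
split=> [|z z' /heitmannP[a [b Jb ->]] /heitmannP[a' [b' Jb' ->]]].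
  apply/heitmannP; exists 0, 0; last by rewrite mulr0 addr0.
  by rewrite inE mul0r jacobson0.
apply/heitmannP; exists (a - a'), (b - b'); last by rewrite mulrBr opprD addrACA.
rewrite inE mulrBl -mulN1r; apply: jacobsonD; first exact: Jb.
by apply: jacobsonMl; exact: Jb'.
Qed.
HB.instance Definition _ x :=
  GRing.isZmodClosed.Build A (heitmann x) (heitmann_zmod_closed x).

Lemma heitmann_mul_stable x c : {in heitmann x, forall u, c * u \in heitmann x}.
Proof.
move=> u /heitmannP[a [b Jb ->]]; apply/heitmannP; exists (c * a), (c * b).
  by rewrite inE -mulrA jacobsonMl.
by rewrite mulrDr mulrCA.
Qed.
HB.instance Definition _ x :=
  isMulStable.Build A (heitmann x) (@heitmann_mul_stable x).

End HeitmannBoundary.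

(* [Hdim_lt n A] is Hdim A <= n - 1; the shift accounts for the base case -1. *)
Fixpoint Hdim_lt (n : nat) (A : comPzRingType) : Prop :=
  match n with
  | 0 => 1 = 0 :> A
  | m.+1 => forall x : A, Hdim_lt m (quot_ring (heitmann x))
  end.

Definition Hdim_le (d : nat) (A : comPzRingType) : Prop := Hdim_lt d.+1 A.

Section Localization.
Variables (A : comPzRingType) (s : A).

Section Module.
Variable M : lmodType A.

(* The pair (m, p) stands for the fraction m / s^p of M[1/s]. *)
Definition loc_eq (x y : M * nat) : bool :=
  `[< exists k, s ^+ (k + y.2) *: x.1 = s ^+ (k + x.2) *: y.1 >].

Lemma loc_eq_refl : reflexive loc_eq.
Proof. by move=> x; apply/asboolP; exists 0. Qed.

Lemma loc_eq_sym : symmetric loc_eq.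
Proof. by move=> x y; apply/asboolP/asboolP => -[k e]; exists k. Qed.

Lemma loc_eq_trans : transitive loc_eq.
Proof.
move=> y x z /asboolP[k xy] /asboolP[l yz]; apply/asboolP.
exists (k + l + y.2)%N.
have -> : (k + l + y.2 + z.2 = (l + z.2) + (k + y.2))%N by ring.
have -> : (k + l + y.2 + x.2 = (k + x.2) + (l + y.2))%N by ring.
by rewrite (exprD s (l + z.2)) (exprD s (k + x.2)) -!scalerA xy -yz !scalerA mulrC.
Qed.

Canonical loc_eq_equiv := EquivRel loc_eq loc_eq_refl loc_eq_sym loc_eq_trans.

Definition loc_mod : Type := {eq_quot loc_eq}.
HB.instance Definition _ := Choice.on loc_mod.

Definition loc_frac (m : M) (p : nat) : loc_mod := \pi_({eq_quot loc_eq}) (m, p).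
Definition loc_repr (u : loc_mod) : M * nat := repr (u : {eq_quot loc_eq}).

Lemma loc_fracP m p n q :
  loc_frac m p = loc_frac n q <->
  exists k, s ^+ (k + q) *: m = s ^+ (k + p) *: n.
Proof.
split=> [/eqP|H]; first by rewrite /loc_frac piE => /asboolP.
by apply/eqP; rewrite /loc_frac piE; apply/asboolP.
Qed.

Lemma loc_frac_repr u : loc_frac (loc_repr u).1 (loc_repr u).2 = u.
Proof. by rewrite /loc_frac -surjective_pairing; apply: reprK. Qed.

Lemma loc_frac_surj u : exists m p, u = loc_frac m p.
Proof. by exists (loc_repr u).1, (loc_repr u).2; rewrite loc_frac_repr. Qed.

Lemma loc_repr_frac m p : exists k,
  s ^+ (k + (loc_repr (loc_frac m p)).2) *: m =
  s ^+ (k + p) *: (loc_repr (loc_frac m p)).1.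
Proof. by apply/loc_fracP; rewrite loc_frac_repr. Qed.

Definition loc_add (u v : loc_mod) : loc_mod :=
  let: ((m, p), (n, q)) := (loc_repr u, loc_repr v) in
  loc_frac (s ^+ q *: m + s ^+ p *: n) (p + q).
Definition loc_opp (u : loc_mod) : loc_mod :=
  let: (m, p) := loc_repr u in loc_frac (- m) p.

Lemma loc_addE m p n q :
  loc_add (loc_frac m p) (loc_frac n q) =
  loc_frac (s ^+ q *: m + s ^+ p *: n) (p + q).
Proof.
rewrite /loc_add; have := loc_repr_frac m p; have := loc_repr_frac n q.
case: (loc_repr _) => n' q' /= [l en]; case: (loc_repr _) => m' p' /= [k em].
apply/loc_fracP; exists (k + l)%N.
rewrite !scalerDr !scalerA -!exprD; congr (_ + _).
  have -> : (k + l + (p + q) + q' = (l + q + q') + (k + p))%N by ring.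
  have -> : (k + l + (p' + q') + q = (l + q + q') + (k + p'))%N by ring.
  by rewrite !(exprD s (l + q + q')) -!scalerA em.
have -> : (k + l + (p + q) + p' = (k + p + p') + (l + q))%N by ring.
have -> : (k + l + (p' + q') + p = (k + p + p') + (l + q'))%N by ring.
by rewrite !(exprD s (k + p + p')) -!scalerA en.
Qed.

Lemma loc_oppE m p : loc_opp (loc_frac m p) = loc_frac (- m) p.
Proof.
rewrite /loc_opp; have := loc_repr_frac m p.
case: (loc_repr _) => m' p' /= [k em].
by apply/loc_fracP; exists k; rewrite !scalerN em.
Qed.

Let loc_addA : associative loc_add.
Proof.
move=> u v w; have [m [p ->]] := loc_frac_surj u.
have [n [q ->]] := loc_frac_surj v; have [o [t ->]] := loc_frac_surj w.
rewrite !loc_addE !scalerDr !scalerA -!exprD addrA addnA.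
by rewrite [(t + q)%N]addnC [(t + p)%N]addnC.
Qed.

Let loc_addC : commutative loc_add.
Proof.
move=> u v; have [m [p ->]] := loc_frac_surj u.
by have [n [q ->]] := loc_frac_surj v; rewrite !loc_addE addrC addnC.
Qed.

Let loc_add0 : left_id (loc_frac 0 0) loc_add.
Proof.
move=> u; have [m [p ->]] := loc_frac_surj u.
by rewrite loc_addE scaler0 scale1r add0r.
Qed.

Let loc_addN : left_inverse (loc_frac 0 0) loc_opp loc_add.
Proof.
move=> u; have [m [p ->]] := loc_frac_surj u; rewrite loc_oppE loc_addE.
by apply/loc_fracP; exists 0; rewrite scalerN addNr !scaler0.
Qed.

HB.instance Definition _ :=
  GRing.isZmodule.Build loc_mod loc_addA loc_addC loc_add0 loc_addN.

End Module.

(* The additive group of A[1/s] is that of the A-module A localized at s. *)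
Definition loc_ring : Type := loc_mod A^o.
HB.instance Definition _ := GRing.Zmodule.on loc_ring.

(* This is the product of A[1/s] when [M] is [A^o]. *)
Definition loc_scale (M : lmodType A) (c : loc_ring) (u : loc_mod M) : loc_mod M :=
  let: ((a, p), (m, q)) := (loc_repr (c : loc_mod A^o), loc_repr u) in
  loc_frac ((a : A) *: m) (p + q).

Definition loc_mul (c d : loc_ring) : loc_ring := @loc_scale A^o c d.

Lemma loc_scaleE (M : lmodType A) (a : A) p (m : M) q :
  loc_scale (loc_frac (a : A^o) p) (loc_frac m q) = loc_frac (a *: m) (p + q).
Proof.
rewrite /loc_scale; have := loc_repr_frac (a : A^o) p.
have := loc_repr_frac m q.
case: (loc_repr _) => m' q' /= [l em]; case: (loc_repr _) => a' p' /= [k ea].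
apply/loc_fracP; exists (k + l)%N.
have -> : (k + l + (p + q) = (k + p) + (l + q))%N by ring.
have -> : (k + l + (p' + q') = (k + p') + (l + q'))%N by ring.
have ea' : s ^+ (k + p') * a = s ^+ (k + p) * a' := ea.
rewrite (exprD s (k + p')) (exprD s (k + p)) !scalerA.
rewrite [_ * a]mulrAC ea'.
by rewrite -[RHS]scalerA em scalerA mulrAC.
Qed.

Let loc_mulA : associative loc_mul.
Proof.
move=> u v w; have [m [p ->]] := loc_frac_surj u.
have [n [q ->]] := loc_frac_surj v; have [o [t ->]] := loc_frac_surj w.
by rewrite /loc_mul !loc_scaleE scalerA addnA.
Qed.

Let loc_mulC : commutative loc_mul.
Proof.
move=> u v; have [m [p ->]] := loc_frac_surj u.
have [n [q ->]] := loc_frac_surj v.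
by rewrite /loc_mul !loc_scaleE addnC; congr loc_frac; apply: mulrC.
Qed.

Let loc_scale1 (M : lmodType A) :
  left_id (loc_frac (1 : A^o) 0 : loc_ring) (@loc_scale M).
Proof.
by move=> u; have [m [p ->]] := loc_frac_surj u; rewrite loc_scaleE scale1r.
Qed.

Let loc_scaleDl (M : lmodType A) (u : loc_mod M) :
  {morph (@loc_scale M)^~ u : c d / c + d}.
Proof.
move=> c d; have [a [p ->]] := loc_frac_surj c.
have [b [q ->]] := loc_frac_surj d; have [m [t ->]] := loc_frac_surj u.
rewrite [loc_frac _ _ + _]loc_addE !loc_scaleE [RHS]loc_addE.
apply/loc_fracP; exists 0.
rewrite !scalerDr !scalerDl !scalerDr !scalerA -!exprD; congr (_ + _).
  by rewrite !mulrA -!exprD; congr (s ^+ _ * _ *: _); ring.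
by rewrite !mulrA -!exprD; congr (s ^+ _ * _ *: _); ring.
Qed.

Let loc_scaleDr (M : lmodType A) : right_distributive (@loc_scale M) +%R.
Proof.
move=> c u v; have [a [t ->]] := loc_frac_surj c.
have [m [p ->]] := loc_frac_surj u; have [n [q ->]] := loc_frac_surj v.
rewrite [loc_frac _ _ + _]loc_addE !loc_scaleE [RHS]loc_addE.
apply/loc_fracP; exists 0.
rewrite !scalerDr !scalerA; congr (_ *: _ + _ *: _); rewrite !exprD; ring.
Qed.

Let loc_mulDl : left_distributive loc_mul +%R.
Proof. by move=> c d u; apply: loc_scaleDl. Qed.

HB.instance Definition _ := GRing.Zmodule_isComPzRing.Build loc_ring
  loc_mulA loc_mulC (@loc_scale1 A^o) loc_mulDl.

Section ModuleStructure.
Variable M : lmodType A.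

Let loc_scaleA (c d : loc_ring) (u : loc_mod M) :
  loc_scale c (loc_scale d u) = loc_scale (c * d) u.
Proof.
have [a [p ->]] := loc_frac_surj c; have [b [q ->]] := loc_frac_surj d.
have [m [t ->]] := loc_frac_surj u.
by rewrite [_ * _]loc_scaleE !loc_scaleE scalerA addnA.
Qed.

HB.instance Definition _ := GRing.Zmodule_isLmodule.Build loc_ring (loc_mod M)
  loc_scaleA (@loc_scale1 M) (@loc_scaleDr M) (@loc_scaleDl M).

End ModuleStructure.

End Localization.

Definition generated_by (A : comPzRingType) (M : lmodType A) (r : nat) : Prop :=
  exists g : 'I_r -> M, forall m : M,
    exists a : 'I_r -> A, m = \sum_(i < r) a i *: g i.

Definition finitely_generated (A : comPzRingType) (M : lmodType A) : Prop :=
  exists n, generated_by M n.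

Definition unimodular (A : comPzRingType) (n : nat) (s : 'I_n -> A) : Prop :=
  exists a : 'I_n -> A, \sum_(i < n) a i * s i = 1.

Definition locally_generated_by
    (A : comPzRingType) (M : lmodType A) (r : nat) : Prop :=
  exists (n : nat) (s : 'I_n -> A),
    unimodular s /\
    forall i, generated_by (loc_mod (s i) M : lmodType (loc_ring (s i))) r.

(* Main.v *)
Require Import Defs.
From mathcomp Require Import all_boot all_algebra.
From HB Require Import structures.
From mathcomp Require Import boolp ring.

Set Implicit Arguments.
Unset Strict Implicit.
Unset Printing Implicit Defensive.

Import GRing.Theory.
Local Open Scope ring_scope.

(** As long as [M] has more than [d + r] generators [m_0, ..., m_q], one of them
    can be removed: there are [t_1, ..., t_q] with
    [M = <m_1 - t_1 m_0, ..., m_q - t_q m_0>].  If [u] is a relation between the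
    [m_i], then modulo these [q] elements [(u_0 + t_1 u_1 + ... + t_q u_q) m_0]
    is zero; so the linear form [u |-> u_0 + sum_i t_i u_i] has to take the value
    1 on the module of relations ([generated_by_drop]).

    Local generation by [r] elements enters through the scalars [a] such that
    [a M] lies in the span of some [r] of the [m_i].  They generate the unit
    ideal, by exchanging local generators one by one for generators [m_j]
    ([local_generators_unit_ideal]); this replaces Fitting ideals and minors.
    Given such an [a], each generator outside the chosen [r] has a relation with
    coefficient [a] at this generator and 0 at the others outside.  If [m_0] is
    outside, then [a] is the value of the form [u |-> u_0] at a relation.
    Otherwise at least [d + 1] of the indices outside are available, all nonzero,
    and [shift_to_unimodular] removes these scalars [a] one after the other from
    an expression of 1, correcting the [t_i] each time and working modulo the
    ideal of the remaining scalars.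

    The dimension is used in [unimodular_shift].  Let [phi], [psi_1, ..., psi_k]
    be linear forms with [k > Hdim A], and let [u_1, ..., u_k] satisfy
    [psi_j (u_i) = a] if [i = j], and 0 otherwise.  If [a] and the values of [phi]
    generate 1, then some [phi + a (t_1 psi_1 + ... + t_k psi_k)] takes the value
    1.  The induction on [k] passes to the quotient by the boundary ideal of
    [b = phi (u_1)].  The last step, from this quotient back to the ring, is
    elementary and is isolated in [comaximal_boundary].

    The shift and the removal of the scalars take place modulo varying ideals of
    [A].  Ideals are predicates on [A], and [Hdim_lt_mod n I] bounds the dimension of [A / I]
    without forming a quotient ring. *)

(** * Ideals and Heitmann dimension modulo an ideal *)

Section Ideals.
Variable A : comPzRingType.
Implicit Types (I : A -> Prop) (x y z a b c : A).

Definition is_ideal I :=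
  [/\ I 0, forall x y, I x -> I y -> I (x + y) & forall a x, I x -> I (a * x)].

Lemma idealB I x y : is_ideal I -> I x -> I y -> I (x - y).
Proof. by move=> [_ ID IM] Ix Iy; rewrite -mulN1r; apply: (ID) => //; apply: (IM). Qed.

Lemma ideal_sum I n (F : 'I_n -> A) :
  is_ideal I -> (forall i, I (F i)) -> I (\sum_(i < n) F i).
Proof. by move=> [I0 ID _] IF; apply: big_ind. Qed.

Definition radical I x := exists n, I (x ^+ n).

Lemma radical_ideal I : is_ideal I -> is_ideal (radical I).
Proof.
move=> II; have [I0 ID IM] := II; split.
- by exists 1; rewrite expr1.
- move=> x y [m Ix] [n Iy]; exists (m + n)%N; rewrite exprDn.
  apply: ideal_sum => // i; rewrite -mulr_natl; apply: (IM).
  have [le_in|lt_ni] := leqP i n.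
    rewrite -addnBA // exprD [x ^+ m * _]mulrC -mulrA; apply: (IM).
    by rewrite mulrC; apply: (IM).
  by rewrite -(subnK (ltnW lt_ni)) (exprD y); do 2!apply: (IM).
- by move=> a x [n Ix]; exists n; rewrite exprMn; apply: (IM).
Qed.

Lemma radicalX I x n : radical I (x ^+ n) -> radical I x.
Proof. by case=> e Ixe; exists (n * e)%N; rewrite exprM. Qed.

(** The preimage in [A] of the Jacobson radical of [A / I]. *)
Definition jacobson_mod I x := forall y, exists v, I ((1 + x * y) * v - 1).

Lemma jacobson_mod_ideal I : is_ideal I -> is_ideal (jacobson_mod I).
Proof.
move=> II; have [I0 ID IM] := II; split.
- by move=> y; exists 1; rewrite mul0r addr0 mulr1 subrr.
- move=> x y Jx Jy z; have [u Iu] := Jx z; have [v Iv] := Jy (z * u).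
  exists (u * v).
  have -> : (1 + (x + y) * z) * (u * v) - 1
     = v * ((1 + x * z) * u - 1) + ((1 + y * (z * u)) * v - 1) by ring.
  by apply: (ID) => //; apply: (IM).
- by move=> a x Jx y; have [v] := Jx (a * y); exists v; rewrite [a * x]mulrC -mulrA.
Qed.

(** The preimage in [A] of the Heitmann boundary ideal of [x] in [A / I]. *)
Definition boundary_mod I x z := exists a, jacobson_mod I ((z - x * a) * x).

(** The quotient of [A / I] by a boundary ideal is the quotient of [A] by
    [boundary_mod I x], so the recursion changes only the ideal. *)
Fixpoint Hdim_lt_mod n I : Prop :=
  if n is m.+1 then forall x, Hdim_lt_mod m (boundary_mod I x) else I 1.

Lemma sub_boundary_mod I x z : is_ideal I -> I z -> boundary_mod I x z.
Proof.
move=> [_ _ IM] Iz; exists 0 => y; exists 1.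
have -> : (1 + (z - x * 0) * x * y) * 1 - 1 = (x * y) * z by ring.
exact: IM.
Qed.

Lemma boundary_mod_ideal I x : is_ideal I -> is_ideal (boundary_mod I x).
Proof.
move=> II; have [J0 JD JM] := jacobson_mod_ideal II; split.
- by apply: sub_boundary_mod; case: II.
- move=> y z [a Ja] [b Jb]; exists (a + b).
  have -> : (y + z - x * (a + b)) * x = (y - x * a) * x + (z - x * b) * x by ring.
  exact: JD.
- move=> c z [a Ja]; exists (c * a).
  have -> : (c * z - x * (c * a)) * x = c * ((z - x * a) * x) by ring.
  exact: JM.
Qed.

(** The iterated quotients of [B] are images of [A] with growing kernels, and each
    boundary ideal pulls back into the boundary ideal modulo [I].  As the kernel
    need only be contained in [I], this also contains the fact that the dimension
    does not increase in a quotient. *)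
Lemma Hdim_lt_mod_surj n (B : comPzRingType) (f : {rmorphism A -> B}) I :
  (forall u, exists x, f x = u) -> (forall x, f x = 0 -> I x) ->
  Hdim_lt n B -> Hdim_lt_mod n I.
Proof.
elim: n B f I => [|n IHn] B f I f_surj kerI /=.
  by move=> B0; apply: kerI; rewrite rmorph1.
move=> HB x.
apply: (IHn _ (quot_proj (heitmann (f x)) \o f : {rmorphism _ -> _})) (HB (f x)).
  move=> u; have [v ->] := quot_proj_surj u; have [y <-] := f_surj v.
  by exists y.
move=> z /= /eqP; rewrite -[0](rmorph0 (quot_proj (heitmann (f x)))).
move=> /eqP/quot_projP; rewrite subr0 => /heitmannP[a [b Jb fz]].
have [a' fa'] := f_surj a; exists a' => y.
have [v fv] := jacobsonP _ Jb (f y); have [v' fv'] := f_surj v.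
exists v'; apply: kerI.
rewrite !(rmorphB, rmorphM, rmorphD, rmorph1) fa' fv' fz [f x * a + b]addrC addrK.
by rewrite fv subrr.
Qed.

Lemma Hdim_lt_mod_ideal n I : is_ideal I -> Hdim_lt n A -> Hdim_lt_mod n I.
Proof.
move=> [I0 _ _]; apply: (Hdim_lt_mod_surj (f := idfun)) => [u|x /= ->] //.
by exists u.
Qed.

(** In terms of a maximal ideal containing [I]: it contains neither [a] nor [x],
    but it contains [x * b], hence [b], hence [a * a * x], a contradiction.  The
    proof makes this explicit: modulo [I], 1 is
    [a ^+ 2 * x ^+ 2 * p ^+ 2 * q ^+ 2 = - x * b * (p ^+ 2 * q ^+ 2)], so a
    number invertible modulo [I] lies in [I]. *)
Lemma comaximal_boundary I a b x p q : is_ideal I ->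
  I (1 - a * p) -> I (1 - x * q) -> I (b + a * a * x) ->
  jacobson_mod I (x * b) -> I 1.
Proof.
move=> II Ip Iq Ib Jxb; have [I0 ID IM] := II.
have [v Iv] := Jxb (p ^+ 2 * q ^+ 2).
have -> : 1 = (1 + x * b * (p ^+ 2 * q ^+ 2)) * v
            - ((1 + x * b * (p ^+ 2 * q ^+ 2)) * v - 1) :> A by ring.
apply: idealB => //; rewrite mulrC; apply: (IM).
have -> : 1 + x * b * (p ^+ 2 * q ^+ 2) =
   (1 + a * p) * (1 - a * p)
   + (a ^+ 2 * p ^+ 2 * (1 + x * q)) * (1 - x * q)
   + (x * p ^+ 2 * q ^+ 2) * (b + a * a * x) by ring.
by apply: (ID); [apply: (ID)|]; apply: (IM).
Qed.

(** * Making a linear form unimodular *)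

Section Shift.
Variable E : lmodType A.
Implicit Types phi : {scalar E}.

Lemma image_mod_ideal I (F : {scalar E}) : is_ideal I ->
  is_ideal (fun z => exists e, I (z - F e)).
Proof.
move=> [I0 ID IM]; split.
- by exists 0; rewrite raddf0 subrr.
- move=> x y [e Ie] [e' Ie']; exists (e + e').
  by rewrite raddfD opprD addrACA; apply: (ID).
- by move=> a x [e Ie]; exists (a *: e); rewrite linearZ -mulrBr; apply: (IM).
Qed.

(** Put [b := phi (u ord0)].  The induction hypothesis, applied modulo the
    boundary ideal of [b] to the remaining [psi], gives a form
    [phi' = phi + a * S] with a value [phi' e] congruent to 1.  Since [phi'] also
    takes the value [b], at [u ord0], the multiples of [b] in the boundary ideal
    can be absorbed, and 1 is a value of [phi'] plus some [x] with [x * b] in the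
    Jacobson radical modulo [I].  The coefficient of [psi ord0] is this [x]. *)
Lemma unimodular_shift k I phi (psi : 'I_k -> {scalar E}) (u : 'I_k -> E) a :
  is_ideal I -> Hdim_lt_mod k I ->
  (forall i j, psi j (u i) = a *+ (i == j)) ->
  (exists e c, I (1 - phi e - a * c)) ->
  exists (t : 'I_k -> A) e, I (1 - (phi e + a * \sum_(j < k) t j * psi j e)).
Proof.
elim: k I psi u => [|k IHk] I psi u II HI psiu [e0 [c0 I0]].
  (* Here [HI] is [I 1]. *)
  exists (fun=> 0), 0; rewrite -[X in I X]mulr1; by case: II => _ _; apply.
pose b := phi (u ord0).
have IB := boundary_mod_ideal b II.
have [||t [e [y]]] := IHk _ (psi \o lift ord0) (u \o lift ord0) IB (HI b).
- by move=> i j; rewrite /= psiu (inj_eq lift_inj).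
- by exists e0, c0; apply: sub_boundary_mod.
set S := fun e => \sum_(j < k) t j * psi (lift ord0 j) e => /=.
rewrite -/(S e); set x := (X in X * b) => Jx.
pose F e' := phi e' + a * (x * psi ord0 e' + S e').
have F_scalar : scalar F.
  move=> c v w; rewrite /F /S !linearP /=.
  under eq_bigr do rewrite linearP /= mulrDr mulrCA.
  by rewrite big_split /= -mulr_sumr; ring.
pose FS : {scalar E} := HB.pack F (GRing.isLinear.Build _ _ _ _ F F_scalar).
have S0 : S (u ord0) = 0.
  by rewrite /S big1 // => j _; rewrite psiu mulr0n mulr0.
have [e1 Ie1] : exists e1, I (1 - FS e1); last first.
  exists (fun j => if unlift ord0 j is Some j' then t j' else x), e1.
  rewrite big_ord_recl unlift_none.
  by under eq_bigr do rewrite liftK.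
(* The first three conditions hold because [F] is congruent
   to [phi] modulo [a] and to [phi + a * S] modulo [x], and because
   [F (u ord0) = b + a * a * x]. *)
apply: (comaximal_boundary (image_mod_ideal FS II) (a := a) (b := b) (x := x)
         (p := c0 - x * psi ord0 e0 - S e0) (q := 1 - a * psi ord0 (e + y *: u ord0))).
- by exists e0; move: I0; rewrite /= /F; congr I; ring.
- exists (e + y *: u ord0).
  have S1 : S (e + y *: u ord0) = S e.
    have SD : scalar S.
      move=> c v w; rewrite /S.
      under eq_bigr do rewrite linearP /= mulrDr mulrCA.
      by rewrite big_split /= -mulr_sumr.
    by rewrite addrC SD S0 mulr0 add0r.
  rewrite /= /F S1 [phi _]raddfD /= [phi (_ *: _)]linearZ /= -/b.
  rewrite /x; case: II => I00 _ _; move: I00; congr I; ring.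
- exists (u ord0); rewrite /= /F S0 psiu eqxx -/b mulr1n.
  by case: II => I00 _ _; move: I00; congr I; ring.
- by move=> z; have [v Iv] := Jx z; exists v, 0; rewrite raddf0 subr0.
Qed.

End Shift.

End Ideals.

(** * Generators of a locally generated module *)

Section Span.
Variables (A : comPzRingType) (M : lmodType A).

Definition in_span n (h : 'I_n -> M) (x : M) : Prop :=
  exists a : 'I_n -> A, x = \sum_(i < n) a i *: h i.

Lemma in_span_gen n (h : 'I_n -> M) i : in_span h (h i).
Proof.
exists (fun j => (j == i)%:R); rewrite (bigD1 i) //= eqxx scale1r big1 ?addr0 //.
by move=> j /negPf->; rewrite scale0r.
Qed.

Lemma in_spanD n (h : 'I_n -> M) x y :
  in_span h x -> in_span h y -> in_span h (x + y).
Proof.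
move=> [a ->] [b ->]; exists (fun i => a i + b i); rewrite -big_split.
by apply: eq_bigr => i _; rewrite scalerDl.
Qed.

Lemma in_spanZ n (h : 'I_n -> M) c x : in_span h x -> in_span h (c *: x).
Proof.
move=> [a ->]; exists (fun i => c * a i); rewrite scaler_sumr.
by apply: eq_bigr => i _; rewrite scalerA.
Qed.

Lemma in_span_sum n (h : 'I_n -> M) p (P : pred 'I_p) (F : 'I_p -> M) :
  (forall i, P i -> in_span h (F i)) -> in_span h (\sum_(i < p | P i) F i).
Proof.
apply: big_ind => [|x y]; last exact: in_spanD.
by exists (fun=> 0); rewrite big1 // => i _; rewrite scale0r.
Qed.

Lemma in_span_trans n p (h : 'I_n -> M) (g : 'I_p -> M) x :
  (forall i, in_span g (h i)) -> in_span h x -> in_span g x.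
Proof. by move=> hg [a ->]; apply: in_span_sum => i _; apply: in_spanZ. Qed.

(** The elements [h l] with [i <= l] are already among the [m j]; the induction on
    [i] exchanges one more.  Write [c *: m j] as a combination of the [h l] with
    coefficients [a j l], and [h i0] as a combination of the [m j] with
    coefficients [b j].  After multiplication by [a j i0], [h i0] can be replaced
    by [m j].  After multiplication by [c - \sum_j b j * a j i0], it lies in the
    span of the other [h l] and can be replaced by anything.  The square [c ^+ 2]
    is a combination of [c] times these multipliers, so [c] itself is reached only
    up to a power. *)
Lemma exchange_generators (K : A -> Prop) N r (m : 'I_N.+1 -> M) :
  is_ideal K -> (forall x, in_span m x) ->
  (forall (T : 'I_r -> 'I_N.+1) a,
     (forall j, in_span (m \o T) (a *: m j)) -> K a) ->
  forall i (h : 'I_r -> M) c, (i <= r)%N ->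
    (forall l : 'I_r, (i <= l)%N -> exists j, h l = m j) ->
    (forall j, in_span h (c *: m j)) -> radical K c.
Proof.
move=> KI m_gen Km; elim=> [|i IHi] h c lt_ir hm ch.
  have [T hT] : exists T : 'I_r -> 'I_N.+1, forall l, h l = m (T l).
    by have [T hT] := choice (fun l => hm l isT); exists T.
  exists 1; rewrite expr1; apply: (Km T) => j.
  by apply: in_span_trans (ch j) => l; rewrite hT; apply: (in_span_gen (m \o T)).
pose i0 := Ordinal lt_ir.
pose h' j l := if l == i0 then m j else h l.
have h'm j (l : 'I_r) : (i <= l)%N -> exists j', h' j l = m j'.
  rewrite /h'; have [->|ne_l] := eqVneq l i0; first by exists j.
  rewrite leq_eqVlt => /orP[/eqP il|/hm//]; case/eqP: ne_l.
  exact: val_inj.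
have hh' j l : l != i0 -> in_span (h' j) (h l).
  by move=> /negPf ne_l; have := in_span_gen (h' j) l; rewrite /h' ne_l.
have [a ca] := choice ch.
have ca' j : c *: m j = a j i0 *: h i0 + \sum_(l < r | l != i0) a j l *: h l.
  by rewrite ca (bigD1 i0).
have rest j j' : in_span (h' j') (c *: m j - a j i0 *: h i0).
  rewrite ca' addrC addKr; apply: in_span_sum => l ne_l.
  by apply: in_spanZ; apply: hh'.
have [b hb] := m_gen (h i0).
pose e := \sum_(j < N.+1) b j * a j i0.
have Kcols j : radical K (c * a j i0).
  apply: (IHi (h' j)) => [||j']; [exact: ltnW|exact: h'm|].
  have ajh : in_span (h' j) (a j i0 *: h i0).
    have -> : a j i0 *: h i0 = c *: m j - (c *: m j - a j i0 *: h i0).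
      by rewrite opprB addrC subrK.
    rewrite -scaleN1r; apply: in_spanD; last by apply: in_spanZ; apply: rest.
    by apply: in_spanZ; have := in_span_gen (h' j) i0; rewrite /h' eqxx.
  rewrite mulrC -scalerA ca scaler_sumr; apply: in_span_sum => l _.
  have [->|ne_l] := eqVneq l i0; last by do 2!apply: in_spanZ; apply: hh'.
  by rewrite scalerA mulrC -scalerA; apply: in_spanZ.
have Krest : radical K (c * (c - e)).
  apply: (IHi (h' ord0)) => [||j]; [exact: ltnW|exact: h'm|].
  have ceh : in_span (h' ord0) ((c - e) *: h i0).
    have -> : (c - e) *: h i0 = \sum_j b j *: (c *: m j - a j i0 *: h i0).
      rewrite scalerBl {1}hb scaler_sumr /e scaler_suml -sumrB.
      by apply: eq_bigr => j' _; rewrite scalerBr !scalerA mulrC.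
    by apply: in_span_sum => j' _; apply: in_spanZ.
  rewrite mulrC -scalerA ca scaler_sumr; apply: in_span_sum => l _.
  have [->|ne_l] := eqVneq l i0; last by do 2!apply: in_spanZ; apply: hh'.
  by rewrite scalerA mulrC -scalerA; apply: in_spanZ.
apply: (@radicalX _ _ _ 2).
have -> : c ^+ 2 = c * (c - e) + \sum_j b j * (c * a j i0).
  have -> : \sum_j b j * (c * a j i0) = c * e.
    by rewrite /e mulr_sumr; apply: eq_bigr => j _; rewrite mulrCA.
  by ring.
have RI := radical_ideal KI; have [_ RD RM] := RI.
by apply: (RD) => //; apply: ideal_sum => // j; apply: (RM).
Qed.

(** Clearing the denominators of the generators of [M[1/s]] and of the
    coefficients that express the [m j] in them. *)
Lemma loc_span_clear s r N (m : 'I_N -> M) :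
  generated_by (loc_mod s M : lmodType (loc_ring s)) r ->
  exists (h : 'I_r -> M) e, forall j, in_span h (s ^+ e *: m j).
Proof.
move=> [g g_gen]; pose h l := (loc_repr (g l)).1; exists h.
have span_num u : exists y n, u = loc_frac s y n /\ in_span h y.
  have [a ->] := g_gen u.
  apply: (big_ind (fun u => exists y n, u = loc_frac s y n /\ in_span h y)).
  - exists 0, 0%N; split=> //; exists (fun=> 0).
    by rewrite big1 // => i _; rewrite scale0r.
  - move=> _ _ [y [n [-> hy]]] [z [p [-> hz]]].
    exists (s ^+ p *: y + s ^+ n *: z), (n + p)%N; split; first exact: loc_addE.
    by apply: in_spanD; apply: in_spanZ.
  - move=> l _; have [c [n ->]] := loc_frac_surj (a l).
    exists (c *: h l), (n + (loc_repr (g l)).2)%N; split.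
      by rewrite -[in LHS](loc_frac_repr (g l)); apply: loc_scaleE.
    by apply: in_spanZ; apply: in_span_gen.
have clear j : exists e, in_span h (s ^+ e *: m j).
  (* Equality of fractions brings in a further power of [s]. *)
  have [y [n [/loc_fracP[k mjy] hy]]] := span_num (loc_frac s (m j) 0).
  by exists (k + n)%N; rewrite mjy; apply: in_spanZ.
have [e he] := choice clear; exists (\sum_j e j)%N => j.
by rewrite (bigD1 j) //= addnC exprD -scalerA; apply: in_spanZ.
Qed.

Lemma local_generators_unit_ideal (K : A -> Prop) N r (m : 'I_N.+1 -> M) :
  is_ideal K -> (forall x, in_span m x) -> locally_generated_by M r ->
  (forall (T : 'I_r -> 'I_N.+1) a,
     (forall j, in_span (m \o T) (a *: m j)) -> K a) ->
  K 1.
Proof.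
move=> KI m_gen [n [s [[a as1] s_gen]]] Km.
have RI := radical_ideal KI; have [_ _ RM] := RI.
suff [e] : radical K 1 by rewrite expr1n.
rewrite -as1; apply: ideal_sum => // i; apply: (RM).
have [h [e he]] := loc_span_clear m (s_gen i).
apply: (@radicalX _ _ _ e).
apply: (exchange_generators KI m_gen Km (leqnn r) _ he) => l.
by rewrite leqNgt ltn_ord.
Qed.

End Span.

(** * Relations between generators *)

Section Relations.
Variables (A : comPzRingType) (M : lmodType A) (N : nat) (m : 'I_N -> M).

Definition is_relation : {pred 'rV[A]_N} :=
  [pred u : 'rV[A]_N | \sum_(i < N) u ord0 i *: m i == 0].

Lemma is_relation_submod : submod_closed is_relation.
Proof.
split=> [|a u v]; rewrite !inE.
  by rewrite big1 // => i _; rewrite mxE scale0r.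
move=> /eqP u0 /eqP v0.
under eq_bigr do rewrite !mxE scalerDl -scalerA.
by rewrite big_split /= -scaler_sumr u0 v0 scaler0 addr0.
Qed.
HB.instance Definition _ :=
  GRing.isSubmodClosed.Build A 'rV[A]_N is_relation is_relation_submod.

Record relations := Relation { rel_coefs :> 'rV[A]_N; _ : rel_coefs \in is_relation }.
HB.instance Definition _ := [isSub for rel_coefs].
HB.instance Definition _ := [Choice of relations by <:].
HB.instance Definition _ := [SubChoice_isSubLmodule of relations by <:].

Implicit Types (t : 'I_N -> A) (u : relations).

(** The relation says that [a *: m k] equals a combination of the [m (T l)]. *)
Lemma relation_of_span r (T : 'I_r -> 'I_N) a k :
  in_span (m \o T) (a *: m k) ->
  exists u : relations, forall j, j \notin codom T -> u ord0 j = a *+ (k == j).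
Proof.
move=> [c ak].
pose v : 'rV[A]_N :=
  a *: delta_mx ord0 k - \sum_(l < r) c l *: delta_mx ord0 (T l).
have vE j : v ord0 j = a *+ (k == j) - \sum_(l < r) c l *+ (T l == j).
  rewrite !mxE summxE eqxx /= [j == k]eq_sym mulr_natr; congr (_ - _).
  by apply: eq_bigr => l _; rewrite !mxE eqxx /= [j == _]eq_sym mulr_natr.
have sum_delta b l : \sum_(j < N) (b *+ (l == j)) *: m j = b *: m l.
  rewrite (bigD1 l) //= eqxx big1 ?addr0 // => j ne_j.
  by rewrite eq_sym (negPf ne_j) scale0r.
have v_rel : v \in is_relation.
  rewrite inE; apply/eqP.
  under eq_bigr do rewrite vE scalerBl scaler_suml.
  rewrite sumrB exchange_big /= sum_delta ak -sumrB big1 // => l _.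
  by rewrite sum_delta subrr.
exists (Relation v_rel) => j; rewrite /= vE => jT.
rewrite big1 ?subr0 // => l _; case: eqP jT => // <-.
by rewrite codom_f.
Qed.

Definition relation_form t u : A := \sum_(i < N) t i * u ord0 i.

Lemma relation_form_scalar t : scalar (relation_form t).
Proof.
move=> a u v; rewrite /relation_form mulr_sumr -big_split.
by apply: eq_bigr => i _; rewrite !mxE mulrDr mulrCA.
Qed.
HB.instance Definition _ t :=
  GRing.isLinear.Build A relations A *%R (relation_form t) (relation_form_scalar t).

Lemma relation_form_delta i u : relation_form (fun j => (i == j)%:R) u = u ord0 i.
Proof.
rewrite /relation_form (bigD1 i) //= eqxx mul1r big1 ?addr0 // => j.
by rewrite eq_sym => /negPf ->; rewrite mul0r.
Qed.

End Relations.

(** * Removing one generator *)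

Section Reduction.
Variables (A : comPzRingType) (M : lmodType A) (q : nat) (m : 'I_q.+1 -> M).
Implicit Types (t : 'I_q.+1 -> A) (u : relations m) (a : A) (s : seq A).

(** Modulo the elements [m i - t i *: m 0] the relation [u] becomes
    [relation_form t u *: m 0 = 0], so [m 0] lies in their span. *)
Lemma generated_by_drop t u : (forall x, in_span m x) ->
  t ord0 = 1 -> relation_form t u = 1 -> generated_by M q.
Proof.
move=> m_gen t0 tu.
pose g i := m (lift ord0 i) - t (lift ord0 i) *: m ord0.
have := valP u; rewrite inE big_ord_recl => /eqP rel_u.
move: tu; rewrite /relation_form big_ord_recl t0 mul1r => tu.
have g0 : in_span g (m ord0).
  exists (fun i => - u ord0 (lift ord0 i)).
  under eq_bigr do rewrite scalerBr scaleNr scalerA mulNr scaleNr opprK.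
  rewrite big_split /= sumrN -scaler_suml.
  under [X in _ + X *: _]eq_bigr do rewrite mulrC.
  rewrite -[in LHS](scale1r (m ord0)) -tu scalerDl; congr (_ + _).
  by apply/eqP; rewrite -addr_eq0 rel_u.
exists g => x; apply: in_span_trans (m_gen x) => i.
have [j ->|->] := unliftP ord0 i; last exact: g0.
rewrite -[m (lift _ _)](subrK (t (lift ord0 j) *: m ord0)).
by apply: in_spanD; [apply: (in_span_gen g)|apply: in_spanZ].
Qed.

Fixpoint in_seq_ideal s z : Prop :=
  if s is a :: s' then exists c, in_seq_ideal s' (z - a * c) else z = 0.

Lemma in_seq_idealD s s' z z' :
  in_seq_ideal s z -> in_seq_ideal s' z' -> in_seq_ideal (s ++ s') (z + z').
Proof.
elim: s z => [|a s IHs] z /= => [-> //|[c sz] sz']; first by rewrite add0r.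
by exists c; rewrite addrAC; apply: IHs.
Qed.

Lemma in_seq_ideal_ideal s : is_ideal (in_seq_ideal s).
Proof.
elim: s => [|a s [I0 ID IM]] /=.
  by split=> // [x y -> ->|a x ->]; rewrite ?addr0 ?mulr0.
split.
- by exists 0; rewrite mulr0 subr0.
- move=> x y [c Ic] [c' Ic']; exists (c + c').
  by rewrite mulrDr opprD addrACA; apply: (ID).
- by move=> b x [c Ic]; exists (b * c); rewrite mulrCA -mulrBr; apply: (IM).
Qed.

(** Written out, [a *: m (S i)] lies in the span of the generators whose index is
    not a value of [S].  The index 0 is excluded since the coefficient of [m 0]
    in the form to be modified must remain 1. *)
Definition splits_off k a : Prop :=
  exists (S : 'I_k -> 'I_q.+1) (u : 'I_k -> relations m),
    (forall j, S j != ord0) /\ forall i j, u i ord0 (S j) = a *+ (i == j).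

(** The scalars in [s] are removed one at a time: [unimodular_shift] is applied
    modulo the ideal generated by the scalars not yet treated, and the correction
    of the form is a correction of [t] at the indices [S j]. *)
Lemma shift_to_unimodular k s t :
  Hdim_lt k A -> (forall a, a \in s -> splits_off k a) -> t ord0 = 1 ->
  (exists u, in_seq_ideal s (1 - relation_form t u)) ->
  exists t' u, t' ord0 = 1 /\ relation_form t' u = 1.
Proof.
move=> HA; elim: s t => [|a s IHs] t sP t0 [v sv].
  by exists t, v; split=> //; apply/esym/subr0_eq.
have [S [u [S0 uS]]] := sP a (mem_head a s).
have I_s := in_seq_ideal_ideal s.
have [||c [v' sv']] := unimodular_shift (phi := relation_form t)
    (psi := fun j => relation_form (fun i => (S j == i)%:R)) (u := u) (a := a)
    I_s (Hdim_lt_mod_ideal I_s HA).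
- by move=> i j /=; rewrite relation_form_delta uS.
- by case: sv => c sv; exists v, c.
apply: (IHs (fun i => t i + a * \sum_(j < k) c j * (S j == i)%:R)).
- by move=> b sb; apply: sP; rewrite inE sb orbT.
- rewrite big1 ?mulr0 ?addr0 // => j _.
  by rewrite (negPf (S0 j)) mulr0.
exists v'; move: sv'; congr (in_seq_ideal _ (1 - _)) => /=.
rewrite /relation_form.
under [RHS]eq_bigr do rewrite mulrDl -mulrA mulr_suml.
rewrite big_split /= -mulr_sumr exchange_big /=; congr (_ + _ * _).
apply: eq_bigr => j _; rewrite mulr_sumr.
by apply: eq_bigr => i _; rewrite mulrA.
Qed.

(** The ideal generated by the scalars that split off [k] generators and by the
    coefficients of [m 0] in the relations.  If it contains 1, then
    [shift_to_unimodular] applies to the form [u |-> u 0]. *)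
Definition drop_ideal k z : Prop :=
  exists s, (forall a, a \in s -> splits_off k a) /\
    exists u, in_seq_ideal s (z - u ord0 ord0).

Lemma drop_ideal_ideal k : is_ideal (drop_ideal k).
Proof.
split.
- by exists [::]; split=> //; exists 0; rewrite /= mxE subrr.
- move=> x y [s [sP [u su]]] [s' [s'P [u' su']]]; exists (s ++ s'); split.
    by move=> a; rewrite mem_cat => /orP[/sP|/s'P].
  by exists (u + u'); rewrite mxE opprD addrACA; apply: in_seq_idealD.
- move=> b x [s [sP [u su]]]; exists s; split=> //.
  exists (b *: u); rewrite mxE -mulrBr.
  by have [_ _] := in_seq_ideal_ideal s; apply.
Qed.

(** If 0 is not a value of [T], the relation for [m 0] has coefficient [a] at
    [m 0].  Otherwise [k] indices outside the image of [T] are automatically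
    nonzero, and their relations show that [a] splits them off. *)
Lemma drop_ideal_span k r (T : 'I_r -> 'I_q.+1) a : (k + r <= q.+1)%N ->
  (forall j, in_span (m \o T) (a *: m j)) -> drop_ideal k a.
Proof.
move=> le_q am; have am' j := relation_of_span (am j).
have [/codomP[l0 Tl0]|T0] := boolP (ord0 \in codom T); last first.
  exists [::]; split=> //; have [u uT] := am' ord0.
  by exists u; rewrite uT // eqxx mulr1n /= subrr.
exists [:: a]; split; last by exists 0, 1; rewrite mxE subr0 mulr1 subrr.
move=> _ /[!inE] /eqP->.
have le_k : (k <= #|[predC codom T]|)%N.
  rewrite -(leq_add2l #|codom T|) cardC card_ord addnC.
  apply: leq_trans le_q; rewrite leq_add2l.
  by rewrite (leq_trans (leq_image_card _ _)) // card_ord.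
pose S j : 'I_q.+1 := enum_val (widen_ord le_k j).
have ST j : S j \notin codom T by have := enum_valP (widen_ord le_k j).
have [u uS] := choice (fun j => am' (S j)).
exists S, u; split=> [j|i j]; last first.
  by rewrite uS // (inj_eq enum_val_inj).
by apply: contraNneq (ST j) => ->; rewrite Tl0 codom_f.
Qed.

Lemma drop_generator d r :
  Hdim_le d A -> locally_generated_by M r -> (d + r <= q)%N ->
  (forall x, in_span m x) -> generated_by M q.
Proof.
move=> HA locM le_q m_gen.
have [s [sP [u su]]] : drop_ideal d.+1 1.
  apply: (local_generators_unit_ideal (drop_ideal_ideal d.+1) m_gen locM) => T a.
  by apply: drop_ideal_span; rewrite addSn.
have [||t [v [t0 tv]]] :=
    shift_to_unimodular (t := fun i => (ord0 == i)%:R) HA sP.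
- by [].
- by exists u; rewrite relation_form_delta.
exact: generated_by_drop t0 tv.
Qed.

End Reduction.

Lemma generated_by_pad (A : comPzRingType) (M : lmodType A) n p :
  generated_by M n -> generated_by M (n + p).
Proof.
move=> [g g_gen]; exists (fun i => if split i is inl j then g j else 0) => x.
apply: in_span_trans (g_gen x) => i.
have := in_span_gen (fun i => if split i is inl j then g j else 0) (lshift p i).
by rewrite (unsplitK (inl i)).
Qed.

Theorem mainTheorem7 (A : comPzRingType) (M : lmodType A) (d r : nat) :
  Hdim_le d A -> finitely_generated M -> locally_generated_by M r ->
  generated_by M (d + r).
Proof.
move=> HA [n /(generated_by_pad (d + r))] + locM.
elim: n => [//|n IHn] [m m_gen].
by apply: IHn; apply: (drop_generator HA locM _ m_gen); apply: leq_addl.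
Qed.
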